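(* There is an algorithm which, given $n\ge1$ and the $n(n+1)/2$ values $\mathrm{EC}(C)$, for all $i$-$j$ carry chains $C$ with $1\le i\le j\le n$, of a conservative pseudo-adder on $n$-bit inputs satisfying the standing assumption, computes the expected absolute error $$\mathrm{Er}_{\mathrm{avg}}=\frac{1}{2^{2n}}\sum_{a,b\in\{0,\dots,2^n-1\}}|s(a,b)-s'(a,b)|$$ in $\Theta(n^2)$ steps, where a step is an elementary arithmetic operation or comparison on numbers at unit cost.
   Context: Inputs: integers $a,b\in\{0,\dots,2^n-1\}$ with binary digits $a_k,b_k$ for $0\le k\le n$, so $a_n=b_n=0$. True carries and sum bits: $c_0=0$, $c_k=a_{k-1}b_{k-1}\lor a_{k-1}c_{k-1}\lor b_{k-1}c_{k-1}$ for $1\le k\le n$, and $s_k=a_k\oplus b_k\oplus c_k$ for $0\le k\le n$; so $s(a,b)=\sum_{k=0}^n s_k2^k=a+b$. Carry chains: for $1\le i\le j\le n$, the pair $(a,b)$ generates the $i$-$j$ carry chain if $a_{i-1}=b_{i-1}=1$, $a_k\ne b_k$ for $i\le k\le j-1$, and $a_j=b_j$. A carry chain is identified with the pair $(i,j)$. Pseudo-adder: functions $c'_k=c'_k(a,b)\in\{0,1\}$ for $0\le k\le n$, where $c'_0=0$ and, for $k\ge1$, $c'_k$ depends only on $a_{k-1},\dots,a_0$ and $b_{k-1},\dots,b_0$. Its computed sum is $s'(a,b)=\sum_{k=0}^n s'_k2^k$ with $s'_k=a_k\oplus b_k\oplus c'_k$. It is conservative if $c'_k(a,b)\le c_k(a,b)$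 for all $k$ and all $(a,b)$. Standing assumption: whenever $(a,b)$ generates the $i$-$j$ carry chain and $i\le k\le j$, the value $c'_k(a,b)$ does not depend on the bits of $a,b$ in positions lower than $i-1$, nor on which pair $(a,b)$ generating the chain is considered. Error of a chain: for an $i$-$j$ carry chain $C$ and any $(a,b)$ generating it, let $(a^C,b^C)$ agree with $(a,b)$ in positions $i-1,\dots,j-1$ and have all other bits $0$. Then $\mathrm{EC}(C)=s(a^C,b^C)-s'(a^C,b^C)$, which by the standing assumption is independent of the choice of $(a,b)$. *)

(* Defs.v *)
From mathcomp Require Import all_boot all_order all_algebra.

Set Implicit Arguments.
Unset Strict Implicit.
Unset Printing Implicit Defensive.

Import Order.TTheory GRing.Theory Num.Theory.

Local Open Scope nat_scope.

Definition bit (a k : nat) : bool := odd (a %/ 2 ^ k).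

Fixpoint carry (a b k : nat) : bool :=
  if k is k'.+1 then
    [|| bit a k' && bit b k', bit a k' && carry a b k' | bit b k' && carry a b k']
  else false.

(* The sum computed from the digits of a and b and a given family of carries. *)
Definition sum_with (c : nat -> bool) (n a b : nat) : nat :=
  \sum_(0 <= k < n.+1) (bit a k (+) bit b k (+) c k) * 2 ^ k.

Definition true_sum (n a b : nat) : nat := sum_with (carry a b) n a b.

(* [pcarry A k a b] is c'_k(a,b); its values are meaningful only for k <= n
   and a, b < 2 ^ n, and every hypothesis below is restricted to that range. *)
Record pseudo_adder (n : nat) := PseudoAdder {
  pcarry : nat -> nat -> nat -> bool;
  pcarry0 : forall a b, a < 2 ^ n -> b < 2 ^ n -> pcarry 0 a b = false;
  pcarry_local : forall k a b a' b', 1 <= k <= n ->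
    a < 2 ^ n -> b < 2 ^ n -> a' < 2 ^ n -> b' < 2 ^ n ->
    (forall l, l < k -> bit a l = bit a' l /\ bit b l = bit b' l) ->
    pcarry k a b = pcarry k a' b'
}.

Definition pseudo_sum (n : nat) (A : pseudo_adder n) (a b : nat) : nat :=
  sum_with (fun k => pcarry A k a b) n a b.

Definition conservative (n : nat) (A : pseudo_adder n) : Prop :=
  forall k a b, k <= n -> a < 2 ^ n -> b < 2 ^ n ->
    pcarry A k a b -> carry a b k.

Definition generates (n a b i j : nat) : Prop :=
  [/\ a < 2 ^ n, b < 2 ^ n, 1 <= i <= j & j <= n] /\
  [/\ bit a i.-1, bit b i.-1,
      forall k, i <= k < j -> bit a k != bit b k
    & bit a j = bit b j].

(* Independence of the digits below i - 1 is the case where the two pairs agree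
   from position i - 1 on. *)
Definition chain_determined (n : nat) (A : pseudo_adder n) : Prop :=
  forall i j a b a' b', generates n a b i j -> generates n a' b' i j ->
    forall k, i <= k <= j -> pcarry A k a b = pcarry A k a' b'.

(* Keep the digits of a in positions i - 1, ..., j - 1 only. *)
Definition restrict (i j a : nat) : nat :=
  \sum_(i.-1 <= k < j) bit a k * 2 ^ k.

Definition error (n : nat) (A : pseudo_adder n) (a b : nat) : int :=
  ((true_sum n a b)%:Z - (pseudo_sum A a b)%:Z)%R.

(* [ec i j] is EC of the i-j carry chain, for all 1 <= i <= j <= n; every such
   (i, j) is generated by some pair, so these values are uniquely determined.
   Nothing is said about [ec i j] for other i, j. *)
Definition is_EC (n : nat) (A : pseudo_adder n) (ec : nat -> nat -> int) : Prop :=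
  forall i j a b, generates n a b i j ->
    ec i j = error A (restrict i j a) (restrict i j b).

Definition Er_avg (n : nat) (A : pseudo_adder n) : rat :=
  ((\sum_(0 <= a < 2 ^ n) \sum_(0 <= b < 2 ^ n) `|error A a b|%:~R)
     / (2 ^ (2 * n))%:R)%R.

(* Algorithms are programs of a small imperative language, with scalar variables
   and two-dimensional arrays holding exact numbers. A step is an arithmetic
   operation or a comparison, including those performed to compute array indices
   and to control loops. Since each test of a loop is a comparison, the time
   spent on assignments and array accesses is at most proportional to the number
   of steps plus one, by a factor depending only on the program. *)

Inductive arith_op := Add | Sub | Mul | Div.

Inductive cmp_op := Le | Lt | Eq.

Inductive expr :=
  | Const of int
  | Var of nat
  | Get of nat & expr & expr
  | Arith of arith_op & expr & expr.

Inductive test := Cmp of cmp_op & expr & expr.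

Inductive prog :=
  | Skip
  | Assign of nat & expr
  | Put of nat & expr & expr & expr
  | Seq of prog & prog
  | If of test & prog & prog
  | While of test & prog.

Record state := State {
  var : nat -> rat;
  arr : nat -> nat -> nat -> rat
}.

Definition set_var (s : state) (x : nat) (v : rat) : state :=
  State (fun y => if y == x then v else var s y) (arr s).

Definition set_arr (s : state) (m i j : nat) (v : rat) : state :=
  State (var s)
    (fun m' i' j' => if [&& m' == m, i' == i & j' == j] then v else arr s m' i' j').

(* Indexing an array by anything but a natural number is an error, so that
   array accesses do not provide a rounding operation for free. *)
Definition to_index (q : rat) : option nat :=
  if q \is a Num.nat then Some (Num.truncn q) else None.

Definition eval_arith (o : arith_op) (x y : rat) : option rat :=
  match o with
  | Add => Some (x + y)%R
  | Sub => Some (x - y)%R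
  | Mul => Some (x * y)%R
  | Div => if (y == 0)%R then None else Some (x / y)%R
  end.

Definition eval_cmp (o : cmp_op) (x y : rat) : bool :=
  match o with
  | Le => (x <= y)%R
  | Lt => (x < y)%R
  | Eq => x == y
  end.

Fixpoint eval (s : state) (e : expr) : option rat :=
  match e with
  | Const z => Some (z%:~R)%R
  | Var x => Some (var s x)
  | Get m e1 e2 =>
      if eval s e1 is Some q1 then
        if eval s e2 is Some q2 then
          if to_index q1 is Some i then
            if to_index q2 is Some j then Some (arr s m i j) else None
          else None
        else None
      else None
  | Arith o e1 e2 =>
      if eval s e1 is Some q1 then
        if eval s e2 is Some q2 then eval_arith o q1 q2 else None
      else None
  end.

Definition eval_test (s : state) (b : test) : option bool :=
  let: Cmp o e1 e2 := b in
  if eval s e1 is Some q1 then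
    if eval s e2 is Some q2 then Some (eval_cmp o q1 q2) else None
  else None.

Fixpoint steps (e : expr) : nat :=
  match e with
  | Const _ | Var _ => 0
  | Get _ e1 e2 => steps e1 + steps e2
  | Arith _ e1 e2 => (steps e1 + steps e2).+1
  end.

Definition test_steps (b : test) : nat :=
  let: Cmp _ e1 e2 := b in (steps e1 + steps e2).+1.

(* [exec p s s' t]: started in s, the program p halts in s' after t steps. *)
Inductive exec : prog -> state -> state -> nat -> Prop :=
  | ExecSkip s : exec Skip s s 0
  | ExecAssign s x e v :
      eval s e = Some v ->
      exec (Assign x e) s (set_var s x v) (steps e)
  | ExecPut s m e1 e2 e q1 q2 i j v :
      eval s e1 = Some q1 -> to_index q1 = Some i ->
      eval s e2 = Some q2 -> to_index q2 = Some j ->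
      eval s e = Some v ->
      exec (Put m e1 e2 e) s (set_arr s m i j v) (steps e1 + steps e2 + steps e)
  | ExecSeq p1 p2 s s1 s2 t1 t2 :
      exec p1 s s1 t1 -> exec p2 s1 s2 t2 ->
      exec (Seq p1 p2) s s2 (t1 + t2)
  | ExecIfTrue b p1 p2 s s' t :
      eval_test s b = Some true -> exec p1 s s' t ->
      exec (If b p1 p2) s s' (test_steps b + t)
  | ExecIfFalse b p1 p2 s s' t :
      eval_test s b = Some false -> exec p2 s s' t ->
      exec (If b p1 p2) s s' (test_steps b + t)
  | ExecWhileTrue b p s s1 s2 t1 t2 :
      eval_test s b = Some true -> exec p s s1 t1 -> exec (While b p) s1 s2 t2 ->
      exec (While b p) s s2 (test_steps b + t1 + t2)
  | ExecWhileFalse b p s :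
      eval_test s b = Some false ->
      exec (While b p) s s (test_steps b).

(* The input: n in variable 0 and the chain errors in array 0; everything else
   is zero. The result is left in variable 0. *)
Definition input (n : nat) (ec : nat -> nat -> int) : state :=
  State (fun x => if x == 0 then (n%:R)%R else 0%R)
        (fun m i j => if m == 0 then ((ec i j)%:~R)%R else 0%R).

Definition output (s : state) : rat := var s 0.

(* Main.v *)
Require Import Defs.
From mathcomp Require Import all_boot all_order all_algebra.
From mathcomp Require Import ring lra zify.

Set Implicit Arguments.
Unset Strict Implicit.
Unset Printing Implicit Defensive.

Import Order.TTheory GRing.Theory Num.Theory.

Local Open Scope ring_scope.

(* Let E(m, j) be the error caused by the digits of a and b below m when the
   digits at m, ..., j - 1 differ and those at j agree. Reading digit m: if
   a_m <> b_m then E(m+1, j) = E(m, j); if both are 0 then E(m+1, j) = E(m, m);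
   if both are 1 then E(m+1, j) = EC(m+1, j) + E(m, m). Summing over the digits
   gives a recurrence for the total of E in O(1) steps per pair (m, j). The same
   works for the total of |E|, since EC(m+1, j) is a multiple of 2^(m+1) while
   |E(m, m)| < 2^(m+1): if EC(m+1, j) is nonzero, it decides the sign, and the
   total of |EC(m+1, j) + E(m, m)| is plus or minus the total without absolute
   values. The error of (a, b) is E(n, n). *)

(** * Binary digits and restriction to a window of positions *)

Lemma big1_nat (R : Type) (idx : R) (op : Monoid.law idx) m n (F : nat -> R) :
  (forall k, (m <= k < n)%N -> F k = idx) ->
  \big[op/idx]_(m <= k < n) F k = idx.
Proof. by move=> h; rewrite big_nat_cond big1 // => k /andP[/h]. Qed.

Lemma bit_small a k : (a < 2 ^ k)%N -> bit a k = false.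
Proof. by move=> h; rewrite /bit divn_small. Qed.

Lemma bit_addl_lt m a k : (k < m)%N -> bit (2 ^ m + a) k = bit a k.
Proof.
move=> h; rewrite /bit divnDl; last exact/dvdn_exp2l/ltnW.
rewrite oddD -expnB ?oddX ?(ltnW h) //.
by case: (m - k)%N (subn_gt0 k m) => [|d]; rewrite ?h.
Qed.

Lemma bit_addl_eq m a : (a < 2 ^ m)%N -> bit (2 ^ m + a) m.
Proof.
by move=> h; rewrite /bit divnDl // divnn expn_gt0 /= (divn_small h).
Qed.

Lemma sum_bits_lt (f : nat -> bool) N :
  (\sum_(0 <= k < N) f k * 2 ^ k < 2 ^ N)%N.
Proof.
elim: N => [|N IH]; first by rewrite big_geq.
by rewrite big_nat_recr //= expnS; case: (f N); lia.
Qed.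

Lemma bit_sum_bits (f : nat -> bool) N l :
  bit (\sum_(0 <= k < N) f k * 2 ^ k)%N l = (l < N)%N && f l.
Proof.
elim: N => [|N IH]; first by rewrite big_geq // /bit div0n.
rewrite big_nat_recr //=.
have [hl|hl|->] := ltngtP l N.
- rewrite ltnS (ltnW hl) /=; case: (f N); last by rewrite mul0n addn0 IH hl.
  by rewrite mul1n addnC bit_addl_lt // IH hl.
- rewrite ltnS leqNgt hl /=; apply: bit_small.
  have := sum_bits_lt f N.+1; rewrite big_nat_recr //= => h.
  by apply: (leq_trans h); rewrite leq_exp2l.
- rewrite ltnSn /=; have h := sum_bits_lt f N.
  case: (f N); last by rewrite mul0n addn0 bit_small.
  by rewrite mul1n addnC bit_addl_eq.
Qed.

(** Starting the sum at 0 gives it the form that [bit_sum_bits] and [sum_bits_lt] handle. *)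
Lemma restrictE i j a :
  restrict i j a = (\sum_(0 <= k < j) ((i.-1 <= k) && bit a k) * 2 ^ k)%N.
Proof.
rewrite /restrict; have [h|h] := leqP i.-1 j.
  rewrite (big_cat_nat (leq0n _) h) /= [X in (X + _)%N]big1_nat ?add0n.
    by apply: eq_big_nat => k /andP[-> _].
  by move=> k /andP[_ hk]; rewrite leqNgt hk.
rewrite big_geq ?(ltnW h) // big1_nat // => k /andP[_ hk].
by rewrite leqNgt (ltn_trans hk h).
Qed.

Lemma bit_restrict i j a l :
  bit (restrict i j a) l = [&& (l < j)%N, (i.-1 <= l)%N & bit a l].
Proof. by rewrite restrictE bit_sum_bits. Qed.

Lemma restrict_lt n i j a : (j <= n)%N -> (restrict i j a < 2 ^ n)%N.
Proof.
move=> h; rewrite restrictE; apply: leq_trans (sum_bits_lt _ _) _.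
by rewrite leq_exp2l.
Qed.

(** * True carries along runs of digits *)

(** When exactly one of the two digits is 1, the majority rule returns the incoming carry. *)
Lemma carry_propagate a b i j k : (i <= k <= j)%N ->
  (forall l, (i <= l < j)%N -> bit a l != bit b l) ->
  carry a b k = carry a b i.
Proof.
move=> /andP[hik hkj] h; elim: k hik hkj => [|k IH] hik hkj.
  by have -> : i = 0%N by lia.
have [->//|ne] := eqVneq i k.+1.
have := h k; rewrite /= IH; [|lia|lia].
by case: (bit a k); case: (bit b k); case: (carry a b i) => // /(_ ltac:(lia)).
Qed.

Lemma carry_zeros a b i j k : (i < k <= j)%N ->
  (forall l, (i <= l < j)%N -> ~~ bit a l && ~~ bit b l) ->
  carry a b k = false.
Proof.
case: k => // k hk h /=.
by have /andP[/negbTE -> /negbTE ->] : ~~ bit a k && ~~ bit b k by apply: h; lia.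
Qed.

Lemma carry_zero_low a b i k : (k <= i)%N ->
  (forall l, (l < i)%N -> ~~ bit a l && ~~ bit b l) ->
  carry a b k = false.
Proof.
by case: k => // k hk h; apply: (@carry_zeros a b 0 i) => // l /andP[_]; exact: h.
Qed.

(** * Errors digit by digit and the error of a chain *)

Definition digit_error {n} (A : pseudo_adder n) (a b k : nat) : int :=
  (bit a k (+) bit b k (+) carry a b k)%:Z -
  (bit a k (+) bit b k (+) pcarry A k a b)%:Z.

Lemma errorE n (A : pseudo_adder n) a b :
  error A a b = \sum_(0 <= k < n.+1) digit_error A a b k * 2 ^+ k.
Proof.
rewrite /error /true_sum /pseudo_sum /sum_with.
rewrite !(big_morph Posz PoszD (erefl 0%:Z)) -sumrB; apply: eq_bigr => k _.
by rewrite !PoszM -mulrBl -natrX natz.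
Qed.

Lemma digit_error_eq0 n (A : pseudo_adder n) a b k :
  conservative A -> (k <= n)%N -> (a < 2 ^ n)%N -> (b < 2 ^ n)%N ->
  carry a b k = false -> digit_error A a b k = 0.
Proof.
move=> hA hk ha hb hc; rewrite /digit_error hc.
case hp: (pcarry A k a b); last by rewrite subrr.
by rewrite (hA _ _ _ hk ha hb hp) in hc.
Qed.

Lemma carry_generates n a b i j k :
  generates n a b i j -> (i <= k <= j)%N -> carry a b k.
Proof.
move=> [[_ _ hij _] [ha hb hne _]] hk.
rewrite (@carry_propagate a b i j) //.
by case: i hij ha hb {hk hne} => // i _ /= -> ->.
Qed.

Lemma generates_restrict n a b i j :
  generates n a b i j -> generates n (restrict i j a) (restrict i j b) i j.
Proof.
move=> [[ha hb hij hjn] [hai hbi hne hj]]; split.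
  by split => //; apply: restrict_lt.
rewrite !bit_restrict hai hbi ltnn leqnn /=; split => //; try lia.
by move=> k hk; rewrite !bit_restrict; move: (hne k hk); lia.
Qed.

(** Outside positions i, ..., j the restricted pair has no true carry, so by conservativity only
    this window contributes. Inside it, the restricted pair generates the same chain, so both pairs
    have the same true carries and, by the standing assumption, the same pseudo-carries. *)
Lemma ecE n (A : pseudo_adder n) ec a b i j :
  conservative A -> chain_determined A -> is_EC A ec ->
  generates n a b i j ->
  ec i j = \sum_(i <= k < j.+1) digit_error A a b k * 2 ^+ k.
Proof.
move=> hA hd hec hg; rewrite (hec _ _ _ _ hg) errorE.
have hg' := generates_restrict hg.
have [[ha hb hij hjn] [hai hbi hne hj]] := hg.
have [ra rb] : (restrict i j a < 2 ^ n)%N /\ (restrict i j b < 2 ^ n)%N.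
  by split; apply: restrict_lt.
have low l : (l < i.-1)%N ->
    ~~ bit (restrict i j a) l && ~~ bit (restrict i j b) l.
  by move=> hl; rewrite !bit_restrict [(i.-1 <= l)%N]leqNgt hl /= !andbF.
have high l : (j <= l < n)%N ->
    ~~ bit (restrict i j a) l && ~~ bit (restrict i j b) l.
  by move=> hl; rewrite !bit_restrict ltnNge; case/andP: hl => -> _.
rewrite (@big_cat_nat _ _ _ i) //=; [|lia].
rewrite [X in X + _]big1_nat ?add0r; last first.
  move=> k hk; rewrite digit_error_eq0 ?mul0r //; first lia.
  by apply: carry_zero_low low; lia.
rewrite (@big_cat_nat _ _ _ j.+1) //=; [|lia].
rewrite [X in _ + X]big1_nat ?addr0; last first.
  move=> k hk; rewrite digit_error_eq0 ?mul0r //; first lia.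
  by apply: (@carry_zeros _ _ j n) => //; lia.
apply: eq_big_nat => k hk; congr (_ * _); rewrite /digit_error.
rewrite (carry_generates hg') ?(carry_generates hg) //.
rewrite (hd _ _ _ _ _ _ hg hg') //.
have [hkj|hkj] := ltnP k j.
  by rewrite !bit_restrict hkj; have -> : (i.-1 <= k)%N by lia.
(* At position j the restricted digits are 0 and those of a and b are equal; the exclusive or is 0
   in both cases. *)
have -> : k = j by lia.
by rewrite !bit_restrict ltnn hj /= addbb.
Qed.

Lemma generates_exists n i j : (1 <= i <= j)%N -> (j <= n)%N ->
  exists a b, generates n a b i j.
Proof.
move=> hij hjn.
(* One number has ones at i - 1, ..., j - 1, the other a single one at i - 1, so they differ exactly
   at i, ..., j - 1. *)
exists (\sum_(0 <= k < j) ((i.-1 <= k)%N : bool) * 2 ^ k)%N,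
       (\sum_(0 <= k < j) ((k == i.-1) : bool) * 2 ^ k)%N.
have h2 : (2 ^ j <= 2 ^ n)%N by rewrite leq_exp2l.
split; first by split => //; apply: (leq_trans (sum_bits_lt _ _)).
by rewrite !bit_sum_bits; split; try lia; move=> k hk; rewrite !bit_sum_bits; lia.
Qed.

(** By [ecE], only digits at positions i and above contribute. *)
Lemma ec_dvd n (A : pseudo_adder n) ec i j :
  conservative A -> chain_determined A -> is_EC A ec ->
  (1 <= i <= j)%N -> (j <= n)%N -> exists z : int, ec i j = z * 2 ^+ i.
Proof.
move=> hA hd hec hij hjn; have [a [b hg]] := generates_exists hij hjn.
rewrite (ecE hA hd hec hg).
exists (\sum_(i <= k < j.+1) digit_error A a b k * 2 ^+ (k - i)).
rewrite mulr_suml; apply: eq_big_nat => k hk.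
by rewrite -mulrA -exprD subnK //; case/andP: hk.
Qed.

Lemma sum_digit_error_lt n (A : pseudo_adder n) a b m :
  `|\sum_(0 <= k < m) digit_error A a b k * 2 ^+ k| < 2 ^+ m.
Proof.
elim: m => [|m IH]; first by rewrite big_geq.
rewrite big_nat_recr //= exprS.
have : `|digit_error A a b m * 2 ^+ m| <= 2 ^+ m.
  rewrite normrM [X in _ * X]ger0_norm ?exprn_ge0 // ler_piMl ?exprn_ge0 //.
  by rewrite /digit_error; do 2 case: (_ (+) _).
rewrite mulr_natl mulr2n => h.
by apply: le_lt_trans (ler_normD _ _) _; apply: ltr_leD IH h.
Qed.

(** * Recursive computation of the error of a pair *)

(* E(m, j) *)
Fixpoint chain_error (ec : nat -> nat -> int) (m j a b : nat) : int :=
  if m is q.+1 then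
    if bit a q == bit b q then
      (if bit a q then ec q.+1 j else 0) + chain_error ec q q a b
    else chain_error ec q j a b
  else 0.

Lemma chain_error_ext ec m j a b a' b' :
  (forall l, (l < m)%N -> bit a l = bit a' l) ->
  (forall l, (l < m)%N -> bit b l = bit b' l) ->
  chain_error ec m j a b = chain_error ec m j a' b'.
Proof.
elim: m j => //= m IH j ha hb.
by rewrite ha // hb // !IH // => l hl; rewrite ?ha ?hb // ltnW.
Qed.

(** Induction on m with j arbitrary, since equal digits at m lead to (m, m), where the run of
    differing digits is empty. *)
Lemma chain_errorE n (A : pseudo_adder n) ec m j a b :
  conservative A -> chain_determined A -> is_EC A ec ->
  (a < 2 ^ n)%N -> (b < 2 ^ n)%N -> (m <= j <= n)%N ->
  (forall k, (m <= k < j)%N -> bit a k != bit b k) -> bit a j = bit b j ->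
  chain_error ec m j a b = \sum_(0 <= k < j.+1) digit_error A a b k * 2 ^+ k.
Proof.
move=> hA hd hec ha hb; elim: m j => [|m IH] j hmj hne hj /=.
  rewrite big1_nat // => k hk.
  rewrite digit_error_eq0 ?mul0r //; first lia.
  (* No carry enters position 0, and differing digits pass this on up to j. *)
  by rewrite (@carry_propagate a b 0 j); [|lia|].
have [e|ne] := eqVneq (bit a m) (bit b m); last first.
  (* The run of differing digits extends down to m. *)
  apply: IH => //; first lia.
  by move=> k hk; have [->//|hkm] := eqVneq k m; apply: hne; lia.
rewrite (IH m) //; [|lia|lia].
rewrite (@big_cat_nat _ _ _ m.+1 0 j.+1) //=; [|lia].
(* Positions m + 1, ..., j remain: two ones at m generate a chain there, while two zeros leave every
   carry there equal to 0. *)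
rewrite addrC; congr (_ + _); case: ifP => am.
  by apply: (ecE hA hd hec); split; split => //=; rewrite -?e //; lia.
rewrite big1_nat // => k hk.
rewrite digit_error_eq0 ?mul0r //; first lia.
rewrite (@carry_propagate a b m.+1 j); [|lia|by []].
by rewrite /= -e am.
Qed.

(** Both digits at n are 0, so [chain_errorE] applies with m = j = n and an empty run. *)
Lemma error_chain_error n (A : pseudo_adder n) ec a b :
  conservative A -> chain_determined A -> is_EC A ec ->
  (a < 2 ^ n)%N -> (b < 2 ^ n)%N -> error A a b = chain_error ec n n a b.
Proof.
move=> hA hd hec ha hb; rewrite errorE; apply/esym.
by apply: chain_errorE => //; rewrite ?leqnn ?bit_small //; lia.
Qed.

Lemma chain_error_lt n (A : pseudo_adder n) ec m a b :
  conservative A -> chain_determined A -> is_EC A ec ->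
  (m <= n)%N -> (a < 2 ^ m)%N -> (b < 2 ^ m)%N ->
  `|chain_error ec m m a b| < 2 ^+ m.+1.
Proof.
move=> hA hd hec hm ha hb; have h2 : (2 ^ m <= 2 ^ n)%N by rewrite leq_exp2l.
rewrite (chain_errorE hA hd hec) ?sum_digit_error_lt ?leqnn ?hm ?bit_small //; try lia.
all: by apply: (leq_trans _ h2).
Qed.

(** * Totals over all pairs and their recurrences *)

Definition sum_pairs (m : nat) (F : nat -> nat -> int) : int :=
  \sum_(0 <= a < 2 ^ m) \sum_(0 <= b < 2 ^ m) F a b.

Lemma eq_sum_pairs m F G :
  (forall a b, (a < 2 ^ m)%N -> (b < 2 ^ m)%N -> F a b = G a b) ->
  sum_pairs m F = sum_pairs m G.
Proof. by move=> h; apply: eq_big_nat => a ha; apply: eq_big_nat => b hb; apply: h. Qed.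

Lemma sum_pairsD m F G :
  sum_pairs m (fun a b => F a b + G a b) = sum_pairs m F + sum_pairs m G.
Proof. by rewrite /sum_pairs -big_split; apply: eq_bigr => a _; rewrite big_split. Qed.

Lemma sum_pairsN m F : sum_pairs m (fun a b => - F a b) = - sum_pairs m F.
Proof. by rewrite /sum_pairs -sumrN; apply: eq_bigr => a _; rewrite sumrN. Qed.

Lemma sum_pairs_const m c : sum_pairs m (fun _ _ => c) = c * 4 ^+ m.
Proof.
by rewrite /sum_pairs !sumr_const_nat !subn0 -mulrnA -expnMn -natrX mulr_natr.
Qed.

Lemma sum_split_top m (F : nat -> int) :
  \sum_(0 <= a < 2 ^ m.+1) F a = \sum_(0 <= a < 2 ^ m) (F a + F (2 ^ m + a)%N).
Proof.
rewrite (@big_cat_nat _ _ _ (2 ^ m)) ?leq_exp2l //= big_split /=; congr (_ + _).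
rewrite -{1}[(2 ^ m)%N]add0n big_addn expnS mul2n -addnn addnK.
by apply: eq_bigr => a _; rewrite addnC.
Qed.

Lemma sum_pairsS m F :
  sum_pairs m.+1 F =
  sum_pairs m (fun a b => F a b + F a (2 ^ m + b)%N +
                 (F (2 ^ m + a)%N b + F (2 ^ m + a)%N (2 ^ m + b)%N)).
Proof.
rewrite /sum_pairs sum_split_top; apply: eq_bigr => a _.
by rewrite !sum_split_top -big_split.
Qed.

(** Of the four choices of the digits at m, the two unequal ones give the first term, two zeros the
    second and two ones the third. The function [f] will be the identity or the absolute value. *)
Lemma sum_chain_errorS (f : int -> int) ec m j :
  sum_pairs m.+1 (fun a b => f (chain_error ec m.+1 j a b)) =
  2 * sum_pairs m (fun a b => f (chain_error ec m j a b)) +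
  (sum_pairs m (fun a b => f (chain_error ec m m a b)) +
   sum_pairs m (fun a b => f (ec m.+1 j + chain_error ec m m a b))).
Proof.
rewrite sum_pairsS mulr_natl mulr2n -!sum_pairsD; apply: eq_sum_pairs => a b ha hb.
(* E(m, i) reads only the digits below m, so adding 2 ^ m does not change it. *)
have X i a' b' : [/\ chain_error ec m i (2 ^ m + a') b' = chain_error ec m i a' b',
    chain_error ec m i a' (2 ^ m + b') = chain_error ec m i a' b' &
    chain_error ec m i (2 ^ m + a') (2 ^ m + b') = chain_error ec m i a' b'].
  by split; apply: chain_error_ext => l hl //; rewrite bit_addl_lt.
rewrite /= !bit_addl_eq // !bit_small //= add0r.
have [-> -> _] := X j a b; have [_ _ ->] := X m a b.
ring.
Qed.

Definition signed_total ec m j := sum_pairs m (chain_error ec m j).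
Definition abs_total ec m j := sum_pairs m (fun a b => `|chain_error ec m j a b|).

Lemma signed_totalS ec m j :
  signed_total ec m.+1 j =
  2 * signed_total ec m j + (ec m.+1 j * 4 ^+ m + 2 * signed_total ec m m).
Proof.
rewrite /signed_total (sum_chain_errorS id) sum_pairsD sum_pairs_const.
ring.
Qed.

(** [S] is the total of EC(m+1, j) + E(m, m) without absolute values; all terms share the sign of a
    nonzero EC(m+1, j), so one sign decision serves all 4 ^ m pairs. *)
Lemma abs_totalS n (A : pseudo_adder n) ec m j :
  conservative A -> chain_determined A -> is_EC A ec -> (m < j <= n)%N ->
  let S := ec m.+1 j * 4 ^+ m + signed_total ec m m in
  abs_total ec m.+1 j = 2 * abs_total ec m j + (abs_total ec m m +
    (if ec m.+1 j == 0 then abs_total ec m m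
     else if 0 < ec m.+1 j then S else - S)).
Proof.
move=> hA hd hec hmj; rewrite /= /abs_total (sum_chain_errorS Num.norm).
do 2 congr (_ + _).
have [z hz] : exists z : int, ec m.+1 j = z * 2 ^+ m.+1.
  by apply: (ec_dvd hA hd hec); lia.
have bnd a b : (a < 2 ^ m)%N -> (b < 2 ^ m)%N ->
    `|chain_error ec m m a b| < 2 ^+ m.+1.
  by apply: (chain_error_lt hA hd hec); lia.
case: eqP => [->|/eqP ne0]; first by apply: eq_sum_pairs => a b _ _; rewrite add0r.
have p2 : (0 : int) < 2 ^+ m.+1 by rewrite exprn_gt0.
have z0 : z != 0 by apply: contraNneq ne0 => z0; rewrite hz z0 mul0r.
rewrite -sum_pairs_const -sum_pairsD hz pmulr_lgt0 //.
case: ifP => zp; rewrite -?sum_pairsN; apply: eq_sum_pairs => a b ha hb.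
  rewrite ger0_norm //; have := bnd a b ha hb.
  (* A positive integer z is at least 1, so the chain error outweighs E(m, m). *)
  have : 2 ^+ m.+1 <= z * 2 ^+ m.+1 by apply: (ler_peMl (ltW p2)); lia.
  lia.
rewrite ler0_norm //; have := bnd a b ha hb.
have : 2 ^+ m.+1 <= - z * 2 ^+ m.+1 by apply: (ler_peMl (ltW p2)); lia.
lia.
Qed.

Lemma Er_avgE n (A : pseudo_adder n) ec :
  conservative A -> chain_determined A -> is_EC A ec ->
  Er_avg A = (abs_total ec n n)%:~R / 4 ^+ n.
Proof.
move=> hA hd hec; rewrite /Er_avg; congr (_ / _); last by rewrite expnM natrX.
rewrite /abs_total /sum_pairs rmorph_sum; apply: eq_big_nat => a ha.
rewrite rmorph_sum; apply: eq_big_nat => b hb.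
by rewrite (error_chain_error hA hd hec).
Qed.

(** * Rules for executions with step counts *)

(** The postcondition also receives the number of steps, so that termination, correctness and cost
    are proved together. *)
Definition runs (P : prog) (s : state) (Q : state -> nat -> Prop) : Prop :=
  exists s' t, exec P s s' t /\ Q s' t.

Lemma runs_conseq P s (Q Q' : state -> nat -> Prop) :
  runs P s Q -> (forall s' t, Q s' t -> Q' s' t) -> runs P s Q'.
Proof. by move=> [s' [t [he hq]]] h; exists s', t; split; last exact: h. Qed.

Lemma runs_assign x e s v (Q : state -> nat -> Prop) :
  eval s e = Some v -> Q (set_var s x v) (steps e) -> runs (Assign x e) s Q.
Proof. by move=> he hq; do 2 eexists; split; [exact: ExecAssign he | ]. Qed.

Lemma runs_seq p1 p2 s (Q : state -> nat -> Prop) :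
  runs p1 s (fun s1 t1 => runs p2 s1 (fun s2 t2 => Q s2 (t1 + t2)%N)) ->
  runs (Seq p1 p2) s Q.
Proof.
move=> [s1 [t1 [h1 [s2 [t2 [h2 hq]]]]]].
by do 2 eexists; split; [apply: ExecSeq h1 h2 | ].
Qed.

Lemma runs_if b p1 p2 s c (Q : state -> nat -> Prop) :
  eval_test s b = Some c ->
  runs (if c then p1 else p2) s (fun s' t => Q s' (test_steps b + t)%N) ->
  runs (If b p1 p2) s Q.
Proof.
case: c => hb [s' [t [he hq]]]; do 2 eexists; split; try exact: hq.
  exact: ExecIfTrue.
exact: ExecIfFalse.
Qed.

(** The lower bound [lo] varies with the iteration because the quadratic lower bound arises by
    adding linear costs. The final failing test accounts for the separate [test_steps b]. *)
Lemma runs_while b p (I : nat -> state -> Prop) (lo : nat -> nat) hi N s :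
  (forall k s, (k < N)%N -> I k s -> eval_test s b = Some true /\
     runs p s (fun s' t => I k.+1 s' /\ (lo k <= t <= hi)%N)) ->
  (forall s, I N s -> eval_test s b = Some false) ->
  I 0%N s ->
  runs (While b p) s (fun s' t => I N s' /\
    (\sum_(0 <= k < N) lo k <= t <= test_steps b + N * (test_steps b + hi))%N).
Proof.
move=> hstep hend h0.
(* Generalized to a run from iteration k with d iterations left, for induction on d. *)
suff H d k s0 : (k + d = N)%N -> I k s0 ->
    runs (While b p) s0 (fun s' t => I N s' /\
      (\sum_(k <= l < N) lo l <= t <= test_steps b + d * (test_steps b + hi))%N).
  exact: (H N).
elim: d k s0 => [|d IH] k s0 hk hI.
  rewrite addn0 in hk; rewrite hk in hI *.
  exists s0, (test_steps b); split; first exact/ExecWhileFalse/hend.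
  by rewrite big_geq // mul0n addn0 leqnn.
have hkN : (k < N)%N by lia.
have [hb [s1 [t1 [he1 [hI1 ht1]]]]] := hstep _ _ hkN hI.
have [s2 [t2 [he2 [hI2 ht2]]]] := IH k.+1 s1 ltac:(lia) hI1.
do 2 eexists; split; first exact: ExecWhileTrue hb he1 he2.
by split=> //; rewrite big_ltn // mulSn; lia.
Qed.

Lemma to_index_nat k : to_index k%:R = Some k.
Proof. by rewrite /to_index natr_nat natrK. Qed.

Lemma runs_put a e1 e2 e s i j v (Q : state -> nat -> Prop) :
  eval s e1 = Some i%:R -> eval s e2 = Some j%:R -> eval s e = Some v ->
  Q (set_arr s a i j v) (steps e1 + steps e2 + steps e)%N ->
  runs (Put a e1 e2 e) s Q.
Proof.
move=> h1 h2 he hq; do 2 eexists; split; last exact: hq.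
exact: ExecPut h1 (to_index_nat i) h2 (to_index_nat j) he.
Qed.

Lemma eval_get s m e1 e2 i j : eval s e1 = Some i%:R -> eval s e2 = Some j%:R ->
  eval s (Get m e1 e2) = Some (arr s m i j).
Proof. by move=> /= -> ->; rewrite !to_index_nat. Qed.

(** * The program *)

(* Variables: 0 holds n, 1 holds m, 2 holds j, 3 holds 4 ^ j, and 4, 5 hold the
   signed and absolute totals at (j, m). Row 0 of arrays 1 and 2 stores the
   totals at (j, j) for j < m. *)
Definition ec_expr := Get 0 (Arith Add (Var 2) (Const 1)) (Var 1).
Definition signed_expr := Get 1 (Const 0) (Var 2).
Definition abs_expr := Get 2 (Const 0) (Var 2).
Definition twice e := Arith Mul (Const 2) e.
(** The quantity [S] of [abs_totalS] at (j, m) instead of (m, j): in the program m is the end of the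
    chain and j the number of digits summed over. *)
Definition top_sum := Arith Add (Arith Mul ec_expr (Var 3)) signed_expr.

(** One step of both recurrences, from (j, m) to (j + 1, m). Variable 3 changes only after [4 ^ j]
    has been used. *)
Definition inner_body :=
  Seq (Assign 4 (Arith Add (twice (Var 4))
         (Arith Add (Arith Mul ec_expr (Var 3)) (twice signed_expr))))
  (Seq (If (Cmp Eq ec_expr (Const 0))
          (Assign 5 (Arith Add (twice (Var 5)) (twice abs_expr)))
       (If (Cmp Lt (Const 0) ec_expr)
          (Assign 5 (Arith Add (twice (Var 5)) (Arith Add abs_expr top_sum)))
          (Assign 5 (Arith Add (twice (Var 5)) (Arith Defs.Sub abs_expr top_sum)))))
  (Seq (Assign 3 (Arith Mul (Const 4) (Var 3)))
       (Assign 2 (Arith Add (Var 2) (Const 1))))).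

Definition inner_loop := While (Cmp Lt (Var 2) (Var 1)) inner_body.

(** For fixed m, j runs from 0 to m. Only the totals at (m, m) are stored, since later passes read
    nothing else. *)
Definition outer_body :=
  Seq (Assign 2 (Const 0))
  (Seq (Assign 3 (Const 1))
  (Seq (Assign 4 (Const 0))
  (Seq (Assign 5 (Const 0))
  (Seq inner_loop
  (Seq (Put 1 (Const 0) (Var 1) (Var 4))
  (Seq (Put 2 (Const 0) (Var 1) (Var 5))
       (Assign 1 (Arith Add (Var 1) (Const 1))))))))).

Definition outer_loop := While (Cmp Le (Var 1) (Var 0)) outer_body.

(** The pass with m = n leaves 4 ^ n, the number of pairs, in variable 3. *)
Definition average_program :=
  Seq outer_loop
      (Assign 0 (Arith Div (Get 2 (Const 0) (Var 0)) (Var 3))).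

(** * Loop invariants, correctness and cost *)

Definition tabulated ec (n m : nat) (s : state) : Prop :=
  [/\ var s 0 = n%:R, var s 1 = m%:R,
      forall i j, arr s 0 i j = (ec i j)%:~R,
      forall i, (i < m)%N -> arr s 1 0 i = (signed_total ec i i)%:~R
    & forall i, (i < m)%N -> arr s 2 0 i = (abs_total ec i i)%:~R].

Definition inner_inv ec (n m j : nat) (s : state) : Prop :=
  tabulated ec n m s /\
  [/\ var s 2 = j%:R, var s 3 = 4 ^+ j,
      var s 4 = (signed_total ec j m)%:~R
    & var s 5 = (abs_total ec j m)%:~R].

(** Variable 3 is initially 0, hence the guard; its value after the last pass is needed for the
    final division. *)
Definition outer_inv ec (n m : nat) (s : state) : Prop :=
  tabulated ec n m s /\ ((0 < m)%N -> var s 3 = 4 ^+ m.-1).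

Lemma eval_ec ec n m j s : tabulated ec n m s -> var s 2 = j%:R ->
  eval s ec_expr = Some (ec j.+1 m)%:~R.
Proof.
move=> [_ h1 ha _ _] h2; rewrite -ha; apply: eval_get; last by rewrite /= h1.
by rewrite /= h2 natr1.
Qed.

Lemma eval_signed ec n m j s : (j < m)%N -> tabulated ec n m s ->
  var s 2 = j%:R -> eval s signed_expr = Some (signed_total ec j j)%:~R.
Proof.
move=> hj [_ _ _ ha _] h2; rewrite -ha //.
by apply: (@eval_get _ _ _ _ 0); rewrite /= ?h2.
Qed.

Lemma eval_abs ec n m j s : (j < m)%N -> tabulated ec n m s ->
  var s 2 = j%:R -> eval s abs_expr = Some (abs_total ec j j)%:~R.
Proof.
move=> hj [_ _ _ _ ha] h2; rewrite -ha //.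
by apply: (@eval_get _ _ _ _ 0); rewrite /= ?h2.
Qed.

Lemma evalD s e1 e2 q1 q2 : eval s e1 = Some q1 -> eval s e2 = Some q2 ->
  eval s (Arith Add e1 e2) = Some (q1 + q2).
Proof. by move=> /= -> ->. Qed.

Lemma evalB s e1 e2 q1 q2 : eval s e1 = Some q1 -> eval s e2 = Some q2 ->
  eval s (Arith Defs.Sub e1 e2) = Some (q1 - q2).
Proof. by move=> /= -> ->. Qed.

Lemma evalM s e1 e2 q1 q2 : eval s e1 = Some q1 -> eval s e2 = Some q2 ->
  eval s (Arith Mul e1 e2) = Some (q1 * q2).
Proof. by move=> /= -> ->. Qed.

Lemma eval_div s e1 e2 q1 q2 : eval s e1 = Some q1 -> eval s e2 = Some q2 ->
  q2 != 0 -> eval s (Arith Div e1 e2) = Some (q1 / q2).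
Proof. by move=> /= -> -> /negbTE /= ->. Qed.

Lemma runs_inner_body n (A : pseudo_adder n) ec m j s :
  conservative A -> chain_determined A -> is_EC A ec ->
  (m <= n)%N -> (j < m)%N -> inner_inv ec n m j s ->
  runs inner_body s (fun s' t => inner_inv ec n m j.+1 s' /\ (1 <= t <= 30)%N).
Proof.
move=> hA hd hec hmn hjm [hT [h2 h3 h4 h5]].
have e_ec := eval_ec hT h2.
have e_S := eval_signed hjm hT h2.
apply: runs_seq; apply: runs_assign.
  apply: evalD; first by apply: evalM; [exact: erefl | exact: erefl].
  apply: evalD; first by apply: evalM; [exact: e_ec | exact: erefl].
  by apply: evalM; [exact: erefl | exact: e_S].
set s1 := set_var _ _ _.
have hT1 : tabulated ec n m s1 by case: hT.
have hj1 : var s1 2 = j%:R by [].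
have e1_ec := eval_ec hT1 hj1.
have e1_S := eval_signed hjm hT1 hj1.
have e1_T := eval_abs hjm hT1 hj1.
have e1_top : eval s1 top_sum =
    Some (ec j.+1 m * 4 ^+ j + signed_total ec j j)%:~R.
  by rewrite intrD intrM rmorphXn; apply: evalD => //; apply: evalM => //=; rewrite h3.
have e1_y : eval s1 (twice (Var 5)) = Some (2 * (abs_total ec j m)%:~R).
  by apply: evalM => //=; rewrite h5.
have e1_2T : eval s1 (twice abs_expr) = Some (2 * (abs_total ec j j)%:~R).
  exact: evalM.
apply: runs_seq.
(* The three branches get a common postcondition; 15 is a rough bound on their cost. *)
apply: (@runs_conseq _ _ (fun s' t =>
    s' = set_var s1 5 (abs_total ec j.+1 m)%:~R /\ (t <= 15)%N)).
  have := abs_totalS hA hd hec (_ : (j < m <= n)%N); rewrite hjm hmn => /(_ isT) hS.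
  apply: runs_if; first by rewrite /eval_test e1_ec; exact: erefl.
  rewrite /eval_cmp intr_eq0 hS; case: eqP => _.
    apply: runs_assign; first exact: evalD e1_y e1_2T.
    split=> //; congr set_var; ring.
  apply: runs_if; first by rewrite /eval_test e1_ec; exact: erefl.
  rewrite /eval_cmp ltr_int; case: ifP => _.
    apply: runs_assign; first exact: evalD e1_y (evalD e1_T e1_top).
    split=> //; congr set_var; ring.
  apply: runs_assign; first exact: evalD e1_y (evalB e1_T e1_top).
  split=> //; congr set_var; ring.
move=> _ t [-> ht].
apply: runs_seq; apply: runs_assign; first exact: erefl.
apply: runs_assign; first exact: erefl.
split; last by rewrite /=; lia.
split; first by case: hT.
split=> //=.
- by rewrite h2 natr1.
- by rewrite h3 exprS.
- by rewrite h4 h3 signed_totalS !intrD !intrM rmorphXn.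
Qed.

(** Each pass costs at most 30 steps and one loop test, which gives 31; the failing test adds 1. *)
Lemma runs_inner_loop n (A : pseudo_adder n) ec m s :
  conservative A -> chain_determined A -> is_EC A ec ->
  (m <= n)%N -> inner_inv ec n m 0 s ->
  runs inner_loop s
    (fun s' t => inner_inv ec n m m s' /\ (m <= t <= 1 + m * 31)%N).
Proof.
move=> hA hd hec hmn h0.
apply: runs_conseq.
  apply: (@runs_while _ _ (inner_inv ec n m) (fun=> 1%N) 30 m) h0.
    move=> j s0 hj hI; split; last exact: (runs_inner_body hA hd hec hmn hj hI).
    by case: hI => [[_ h1 _ _ _] [h2 _ _ _]]; rewrite /= h1 h2 ltr_nat hj.
  by move=> s0 [[_ h1 _ _ _] [h2 _ _ _]]; rewrite /= h1 h2 ltxx.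
by move=> s' t /=; rewrite sum_nat_const_nat subn0 muln1.
Qed.

Lemma signed_total0 ec m : signed_total ec 0 m = 0.
Proof. exact: etrans (sum_pairs_const 0 0) (mul0r _). Qed.

Lemma abs_total0 ec m : abs_total ec 0 m = 0.
Proof. exact: etrans (sum_pairs_const 0 0) (mul0r _). Qed.

(** Besides the inner loop only the increment of m costs a step, so the total is at most 2 + m * 31,
    made uniform by m <= n. *)
Lemma runs_outer_body n (A : pseudo_adder n) ec m s :
  conservative A -> chain_determined A -> is_EC A ec ->
  (m <= n)%N -> outer_inv ec n m s ->
  runs outer_body s
    (fun s' t => outer_inv ec n m.+1 s' /\ (m <= t <= 2 + n * 31)%N).
Proof.
move=> hA hd hec hmn [hT _].
do 4 (apply: runs_seq; apply: runs_assign; first exact: erefl).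
apply: runs_seq; apply: runs_conseq.
  apply: (runs_inner_loop hA hd hec hmn); split; first by case: hT.
  by rewrite signed_total0 abs_total0.
move=> s' t [[[h0 h1 hec' hS hT'] [h2 h3 h4 h5]] ht].
do 2 (apply: runs_seq; apply: (@runs_put _ _ _ _ _ 0 m);
  [exact: erefl | by rewrite /= h1 | exact: erefl | ]).
apply: runs_assign; first exact: erefl.
split; last by rewrite /=; nia.
split=> //; split=> //=.
- by rewrite h1 natr1.
(* Entry m has just been written, and the smaller ones are unchanged. *)
- move=> i; rewrite ltnS leq_eqVlt; case: eqP => [->|_] //= hi.
  exact: hS.
- move=> i; rewrite ltnS leq_eqVlt; case: eqP => [->|_] //= hi.
  exact: hT'.
Qed.

(** Pass m of the outer loop costs at least m steps; this makes their sum quadratic. *)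
Lemma sum_id_ge n : (n ^ 2 <= 2 * \sum_(0 <= k < n.+1) k)%N.
Proof.
elim: n => [|n IH]; first by rewrite big_nat1.
by rewrite big_nat_recr //=; nia.
Qed.

Lemma runs_average_program n (A : pseudo_adder n) ec :
  conservative A -> chain_determined A -> is_EC A ec -> (1 <= n)%N ->
  runs average_program (input n ec)
    (fun s t => output s = Er_avg A /\ (n ^ 2 <= 2 * t <= 200 * n ^ 2)%N).
Proof.
move=> hA hd hec hn; apply: runs_seq; apply: runs_conseq.
  (* There are n + 1 passes, as m runs from 0 to n inclusive. *)
  apply: (@runs_while _ _ (outer_inv ec n) id (2 + n * 31) n.+1).
  - move=> m s hm hI; split; last exact: (runs_outer_body hA hd hec hm hI).
    by case: hI => [[h0 h1 _ _ _] _]; rewrite /= h0 h1 ler_nat -ltnS hm.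
  - by move=> s [[h0 h1 _ _ _] _]; rewrite /= h0 h1 ler_nat ltnn.
  - by split.
move=> s t [[[h0 h1 _ _ hT] h3] ht].
apply: runs_assign.
  apply: (eval_div (q2 := 4 ^+ n)); last by rewrite expf_neq0.
    by apply: (@eval_get _ _ _ _ 0); rewrite /= ?h0.
  by rewrite /= h3.
split; first by rewrite (Er_avgE hA hd hec) /= hT.
(* With the division, t is at most 31 n^2 + 34 n + 5, hence at most 100 n^2 because n >= 1. *)
by move: ht (sum_id_ge n); rewrite /=; nia.
Qed.

Theorem mainTheorem4 :
  exists (P : prog) (c1 c2 : rat),
    [/\ 0 < c1, 0 < c2
      & forall (n : nat) (A : pseudo_adder n) (ec : nat -> nat -> int),
          (1 <= n)%N -> conservative A -> chain_determined A -> is_EC A ec ->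
          exists (s : state) (t : nat),
            [/\ exec P (input n ec) s t,
                output s = Er_avg A
              & c1 * n%:R ^+ 2 <= t%:R <= c2 * n%:R ^+ 2]].
Proof.
exists average_program, 2^-1, 100; split=> // n A ec hn hA hd hec.
have [s [t [he [ho /andP[h1 h2]]]]] := runs_average_program hA hd hec hn.
exists s, t; split=> //.
move: h1 h2; rewrite -!(ler_nat rat) !natrM expr2; lra.
Qed.
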